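(* Let $m$ be an even positive integer, $n$ a positive integer, and let $\mathcal{C}$ and $\mathcal{C}'$ be two order $m$ dimension $n$ symmetric Cauchy tensors with generating vectors $c=(c_1,\ldots,c_n)\in\mathbb{R}^n$ and $c'=(c_1',\ldots,c_n')\in\mathbb{R}^n$ respectively. If $\mathcal{C}$ and $\mathcal{C}'$ are positive semi-definite, then the Hadamard product $\mathcal{C}\circ\mathcal{C}'$ is a positive semi-definite tensor.
   Context: $[n]=\{1,\ldots,n\}$. An order $m$ dimension $n$ symmetric Cauchy tensor with generating vector $c=(c_1,\ldots,c_n)\in\mathbb{R}^n$ is the real tensor $\mathcal{C}=(c_{i_1\cdots i_m})$ with entries $c_{i_1i_2\cdots i_m}=\frac{1}{c_{i_1}+c_{i_2}+\cdots+c_{i_m}}$, $i_1,\ldots,i_m\in[n]$, where it is assumed that $c_{i_1}+\cdots+c_{i_m}\neq 0$ for all $i_1,\ldots,i_m\in[n]$. The Hadamard product of order $m$ dimension $n$ tensors $\mathcal{A}=(a_{i_1\cdots i_m})$ and $\mathcal{B}=(b_{i_1\cdots i_m})$ is the order $m$ dimension $n$ tensor $\mathcal{A}\circ\mathcal{B}=(a_{i_1\cdots i_m}b_{i_1\cdots i_m})$. A tensor $\mathcal{A}$ of order $m$ and dimension $n$ is positive semi-definite if $\mathcal{A}x^m:=\sum_{i_1,\ldots,i_m\in[n]}a_{i_1\cdots i_m}x_{i_1}\cdots x_{i_m}\ge 0$ for all $x\in\mathbb{R}^n$. *)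

(* Defs.v *)
From HB Require Import structures.
From mathcomp Require Import all_boot all_order all_algebra.
From mathcomp Require Import reals.

Set Implicit Arguments.
Unset Strict Implicit.
Unset Printing Implicit Defensive.

Import Order.TTheory GRing.Theory Num.Theory.
Local Open Scope ring_scope.

(* The multi-index (i_1, ..., i_m) is a finite function i : 'I_m -> 'I_n, with
   0-based indices. *)
Definition tensor (R : realType) (m n : nat) : Type :=
  {ffun {ffun 'I_m -> 'I_n} -> R}.

(* Inversion is total (0^-1 = 0), so the first conjunct is what makes the
   entries genuine reciprocals. *)
Definition symmetric_Cauchy_tensor (R : realType) (m n : nat)
    (c : 'rV[R]_n) (A : tensor R m n) : Prop :=
  (forall i : {ffun 'I_m -> 'I_n}, \sum_(k < m) c 0 (i k) != 0) /\
  (forall i : {ffun 'I_m -> 'I_n}, A i = 1 / (\sum_(k < m) c 0 (i k))).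

Definition hadamard (R : realType) (m n : nat) (A B : tensor R m n) :
    tensor R m n :=
  [ffun i => A i * B i].

(* The homogeneous form A x^m. *)
Definition tensor_form (R : realType) (m n : nat)
    (A : tensor R m n) (x : 'rV[R]_n) : R :=
  \sum_(i : {ffun 'I_m -> 'I_n}) A i * \prod_(k < m) x 0 (i k).

Definition tensor_psd (R : realType) (m n : nat) (A : tensor R m n) : Prop :=
  forall x : 'rV[R]_n, 0 <= tensor_form A x.

(* Main.v *)
(* Testing C and C' on coordinate vectors shows that all c_i and c'_i are
   positive.  For s = c_{i_1} + ... + c_{i_m} and s' defined likewise,
   1 / (s s') is the limit, as h -> 0+, of h^2 / ((1 - e^{-hs}) (1 - e^{-hs'})),
   that is, of h^2 times a double geometric series.  Exchanging sums, the form of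
   the partial sums is  sum_{k,l} (sum_i x_i e^{-hk c_i} e^{-hl c'_i})^m,  which is
   nonnegative because m is even; nonnegativity passes to both limits. *)
Require Import Defs.
From HB Require Import structures.
From mathcomp Require Import all_boot all_order all_algebra.
From mathcomp Require Import reals.
From mathcomp Require Import boolp classical_sets filter topology.
From mathcomp Require Import normedtype sequences derive exp.

Set Implicit Arguments.
Unset Strict Implicit.
Unset Printing Implicit Defensive.

Import Order.TTheory GRing.Theory Num.Theory.
Import numFieldNormedType.Exports.
Local Open Scope ring_scope.

Lemma tensor_form_delta (R : realType) (m n : nat) (A : tensor R m n)
    (j : 'I_n) :
  tensor_form A (delta_mx 0 j) = A [ffun=> j].
Proof.
rewrite /tensor_form (bigD1 [ffun=> j]) //= [X in _ + X]big1 => [|i ij].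
  rewrite big1 ?mulr1 ?addr0 // => k _.
  by rewrite mxE ffunE !eqxx.
have [k ikj] : exists k, i k != j.
  apply/existsP; apply: contraNT ij; rewrite negb_exists => /forallP iE.
  by apply/eqP/ffunP => k; rewrite ffunE; apply/eqP; move: (iE k); rewrite negbK.
by rewrite (bigD1 k) //= mxE (negbTE ikj) andbF mul0r mulr0.
Qed.

(** At the [j]-th coordinate vector the form equals the diagonal entry 1/(m c_j); it is nonnegative
    and its denominator is nonzero, so m c_j > 0. *)
Lemma psd_Cauchy_gt0 (R : realType) (m n : nat) (c : 'rV[R]_n)
    (C : tensor R m n) :
  symmetric_Cauchy_tensor c C -> tensor_psd C -> forall j, 0 < c 0 j.
Proof.
move=> [Cneq0 CE] psdC j.
have sumE : \sum_(k < m) c 0 ([ffun=> j] k : 'I_n) = c 0 j *+ m.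
  under eq_bigr do rewrite ffunE.
  by rewrite sumr_const card_ord.
have := psdC (delta_mx 0 j); have := Cneq0 [ffun=> j].
rewrite tensor_form_delta CE sumE div1r invr_ge0 => cm_neq0 cm_ge0.
have : 0 < c 0 j *+ m by rewrite lt_neqAle eq_sym cm_neq0.
by apply: contraTT; rewrite -!leNgt => c_le0; rewrite mulrn_wle0.
Qed.

(** Both inverses are sums of geometric series whose ratios are products over the multi-index, so
    truncation gives a sum of [m]-th powers of linear forms in [x]. It is applied with a_j = e^{-h
    c_j} and b_j = e^{-h c'_j}. *)
Lemma geometric_form_ge0 (R : realType) (m n : nat) (a b : 'I_n -> R)
    (x : 'rV[R]_n) :
  ~~ odd m ->
  (forall i : {ffun 'I_m -> 'I_n}, `|\prod_k a (i k)| < 1) ->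
  (forall i : {ffun 'I_m -> 'I_n}, `|\prod_k b (i k)| < 1) ->
  0 <= \sum_(i : {ffun 'I_m -> 'I_n})
         (1 - \prod_k a (i k))^-1 * (1 - \prod_k b (i k))^-1
         * \prod_k x 0 (i k).
Proof.
move=> m_even a_lt1 b_lt1.
pose S (z : R) N := series (geometric 1 z) N.
pose F N := \sum_(i : {ffun 'I_m -> 'I_n})
  S (\prod_k a (i k)) N * S (\prod_k b (i k)) N * \prod_k x 0 (i k).
have F_ge0 N : 0 <= F N.
  suff -> : F N = \sum_(0 <= k < N) \sum_(0 <= l < N)
      (\sum_j x 0 j * a j ^+ k * b j ^+ l) ^+ m.
    by do 2 (apply: sumr_ge0 => ? _); rewrite exprn_even_ge0.
  transitivity (\sum_(0 <= k < N) \sum_(0 <= l < N)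
      \sum_(i : {ffun 'I_m -> 'I_n}) \prod_(j < m)
        (x 0 (i j) * a (i j) ^+ k * b (i j) ^+ l)).
    rewrite /F /S /series /=.
    under [RHS]eq_bigr do rewrite exchange_big /=.
    rewrite [RHS]exchange_big /=; apply: eq_bigr => i _.
    rewrite big_distrlr /= mulr_suml; apply: eq_bigr => k _.
    rewrite mulr_suml; apply: eq_bigr => l _.
    by rewrite !mul1r !big_split /= !prodrXl mulrC mulrA.
  apply: eq_bigr => k _; apply: eq_bigr => l _.
  (* Distributivity: summing the products over all multi-indices gives a product of [m] equal
     sums. *)
  rewrite -(bigA_distr_bigA (fun _ j => x 0 j * a j ^+ k * b j ^+ l)) /=.
  by rewrite prodr_const card_ord.
apply: (@cvgr_to_ge _ \oo%classic _ _ F); last by near=> N; exact: F_ge0.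
apply: cvg_big => [|i _]; first exact: add_continuous.
  apply: cvgM; last exact: cvg_cst.
  by apply: cvgM; rewrite -[_^-1]mul1r; exact: cvg_geometric_series.
Unshelve. all: by end_near.
Qed.

(** The expression is minus the reciprocal of the difference quotient at 0 of e^{-hs}, whose
    derivative there is -s. *)
Lemma cvg_inv_1BexpR (R : realType) (s : R) : s != 0 ->
  (h * (1 - expR (- (h * s)))^-1 @[h --> 0^'+] --> s^-1)%classic.
Proof.
move=> s_neq0.
have dg : is_derive (0 : R) 1 (fun h : R => expR (- (h * s))) (- s).
  apply: is_derive_eq; rewrite mul0r oppr0 expR0.
  by rewrite scaler0 add0r mul1r [s%:A]mulr1.
have := @ex_derive _ _ _ _ _ _ _ dg.
rewrite /derivable => /cvg_dnbhs_at_right.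
have := @derive_val _ _ _ _ _ _ _ dg; rewrite /derive => -> /=.
move=> /cvgN/(cvgV _); rewrite opprK => /(_ s_neq0).
(* This identity holds even at h = 0, where both sides are 0 by the convention 0^-1 = 0. *)
rewrite (_ : (fun h => h * _) = fun h => (- (h^-1 *:
  (expR (- ((h%:A + 0) * s)) - expR (- (0 * s)))))^-1) //.
apply/funext => h /=; rewrite [h%:A]mulr1 addr0 mul0r oppr0 expR0.
by rewrite [_ *: _]mulrC -[- (_ / h)]mulNr opprB invfM invrK mulrC.
Qed.

Theorem theorem2p7 (R : realType) (m n : nat)
    (m_gt0 : (0 < m)%N) (m_even : ~~ odd m) (n_gt0 : (0 < n)%N)
    (c c' : 'rV[R]_n) (C C' : tensor R m n)
    (hC : symmetric_Cauchy_tensor c C)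
    (hC' : symmetric_Cauchy_tensor c' C')
    (psdC : tensor_psd C) (psdC' : tensor_psd C') :
  tensor_psd (hadamard C C').
Proof.
move=> x.
have c_gt0 := psd_Cauchy_gt0 hC psdC.
have c'_gt0 := psd_Cauchy_gt0 hC' psdC'.
have [s_neq0 CE] := hC; have [s'_neq0 C'E] := hC'.
have expR_prod (d : 'rV[R]_n) (h : R) (i : {ffun 'I_m -> 'I_n}) :
    \prod_k expR (- (h * d 0 (i k))) = expR (- (h * \sum_k d 0 (i k))).
  by rewrite -expR_sum sumrN mulr_sumr.
have expR_lt1 (d : 'rV[R]_n) (h : R) (i : {ffun 'I_m -> 'I_n}) :
    (forall j, 0 < d 0 j) -> 0 < h ->
    `|\prod_k expR (- (h * d 0 (i k)))| < 1.
  move=> d_gt0 h_gt0; rewrite expR_prod ger0_norm ?expR_ge0 // expR_lt1 oppr_lt0.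
  (* The sum of the [d 0 (i k)] is positive because it has a first term, as [m] is positive. *)
  rewrite mulr_gt0 // (bigD1 (Ordinal m_gt0)) //= ltr_wpDr ?d_gt0 //.
  by apply: sumr_ge0 => k _; exact: ltW.
pose F h := \sum_(i : {ffun 'I_m -> 'I_n})
  (h * (1 - expR (- (h * \sum_k c 0 (i k))))^-1)
  * (h * (1 - expR (- (h * \sum_k c' 0 (i k))))^-1) * \prod_k x 0 (i k).
(* [F h] tends to the form of the Hadamard product at [x], so its nonnegativity for small h > 0
   suffices. *)
apply: (@cvgr_to_ge _ (0^'+)%classic _ _ F).
  apply: cvg_big => [|i _]; first exact: add_continuous.
  apply: cvgM; last exact: cvg_cst.
  rewrite /hadamard ffunE CE C'E !div1r.
  by apply: cvgM; exact: cvg_inv_1BexpR.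
near=> h.
have h_gt0 : 0 < h by near: h; exact: nbhs_right_gt.
have -> : F h = h ^+ 2 * \sum_(i : {ffun 'I_m -> 'I_n})
    (1 - \prod_k expR (- (h * c 0 (i k))))^-1
    * (1 - \prod_k expR (- (h * c' 0 (i k))))^-1 * \prod_k x 0 (i k).
  rewrite mulr_sumr; apply: eq_bigr => i _.
  by rewrite !expR_prod mulrACA -expr2 !mulrA.
rewrite mulr_ge0 ?sqr_ge0 //.
by apply: (geometric_form_ge0 (a := fun j => expR (- (h * c 0 j)))
  (b := fun j => expR (- (h * c' 0 j)))) => // i; exact: expR_lt1.
Unshelve. all: by end_near.
Qed.
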